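(* Let $N\ge 4$ be an integer, let $p\in\mathbb{Z}\setminus\{0,1,-1\}$, and let $a,b\in\mathbb{R}$ with $ab\ne 0$. Consider the equations of motion $$\ddot q_j=\sum_{l\neq j}\kappa_{jl}(q_l-q_j),\qquad j=0,1,\dots,N-1,$$ with $Z_N$-symmetric force coefficients satisfying the restriction $$\kappa_o=\kappa_1=\kappa_3=\kappa_5=\cdots,\qquad \kappa_e=\kappa_2=\kappa_4=\kappa_6=\cdots.$$ (1) If $N$ is even, there exist real $\kappa_o,\kappa_e$ such that the $N$-body choreographic motion on the $p$-limaçon curve $q(t)=a(\cos t,\sin t)+b(\cos pt,\sin pt)$ satisfies the equations of motion if and only if $p/N\notin\mathbb{Z}$, $(p+1)/N\notin\mathbb{Z}$, $(p-1)/N\notin\mathbb{Z}$ and $p\equiv N/2 \pmod N$. In that case $\kappa_o=p^2/N$ and $\kappa_e=(2-p^2)/N$. (2) If $N$ is odd, there exist real $\kappa_o,\kappa_e$ such that the $N$-body choreographic motion on this $p$-limaçon curve satisfies the equations of motion if and only if $p/N\notin\mathbb{Z}$, $(p+1)/N\notin\mathbb{Z}$ and $(p-1)/N\notin\mathbb{Z}$. In that case $\kappa_o$ and $\kappa_e$ are uniquely determined by $p$ and $N$.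
   Context: The $p$-limaçon curve with parameters $a,b$ is $q(t)=a(\cos t,\sin t)+b(\cos pt,\sin pt)\in\mathbb{R}^2$. The $N$-body choreographic motion on it is $q_k(t)=q\left(t+\frac{2\pi k}{N}\right)$, $k=0,1,\dots,N-1$ (all masses equal $1$; collisions are allowed). The force coefficients $\kappa_{jl}=\kappa_{lj}\in\mathbb{R}$ are $Z_N$-symmetric if, for $j\ne l$, $\kappa_{jl}=\kappa_d$ where $d=\min(|j-l|,N-|j-l|)\in\{1,\dots,\lfloor N/2\rfloor\}$. In the restriction, the indices of $\kappa_1,\kappa_2,\dots$ run over $1,\dots,\lfloor N/2\rfloor$. *)

(* Defs.v *)
From HB Require Import structures.
From mathcomp Require Export all_boot all_order all_algebra.
From mathcomp Require Export all_classical all_reals all_analysis.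

Set Implicit Arguments.
Unset Strict Implicit.
Unset Printing Implicit Defensive.

Export Order.TTheory GRing.Theory Num.Theory.
Export numFieldNormedType.Exports.

Local Open Scope ring_scope.

Section Choreography.
Context {R : realType}.

Definition circle (t : R) : 'rV[R]_2 :=
  \row_(i < 2) (if i == 0 then cos t else sin t).

Definition limacon (p : int) (a b : R) (t : R) : 'rV[R]_2 :=
  a *: circle t + b *: circle (p%:~R * t).

Definition choreography (N : nat) (q : R -> 'rV[R]_2) (k : 'I_N) (t : R) :
    'rV[R]_2 :=
  q (t + 2 * pi * k%:R / N%:R).

(* [kappa j j] never enters, since the sum omits [l = j]. *)
Definition equations_of_motion (N : nat) (kappa : 'I_N -> 'I_N -> R)
    (q : 'I_N -> R -> 'rV[R]_2) : Prop :=
  forall (j : 'I_N) (t : R),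
    derive1n 2 (q j) t = \sum_(l < N | l != j) kappa j l *: (q l t - q j t).

(* [`|j - l|%N] is the absolute difference; the outer subtraction is the
   truncated one of [nat], harmless here because [`|j - l| < N]. *)
Definition cyclic_dist (N : nat) (j l : 'I_N) : nat :=
  minn `|j - l|%N (N - `|j - l|%N)%N.

(* The values [kd d] only matter for [1 <= d <= N./2], the range of
   [cyclic_dist] off the diagonal.  The symmetry [kappa j l = kappa l j] for
   [j != l] follows. *)
Definition ZN_symmetric (N : nat) (kappa : 'I_N -> 'I_N -> R) (kd : nat -> R) :
    Prop :=
  forall j l : 'I_N, j != l -> kappa j l = kd (cyclic_dist j l).

Definition parity_restricted (N : nat) (kd : nat -> R) (ko ke : R) : Prop :=
  forall d : nat, (1 <= d <= N./2)%N -> kd d = if odd d then ko else ke.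

Definition limacon_choreography_solves (N : nat) (p : int) (a b ko ke : R) :
    Prop :=
  exists (kappa : 'I_N -> 'I_N -> R) (kd : nat -> R),
    [/\ ZN_symmetric kappa kd, parity_restricted N kd ko ke &
        equations_of_motion kappa (choreography (limacon p a b))].

End Choreography.

(* Main.v *)
From mathcomp Require Import ring lra zify.
Require Import Defs.

(** In a choreography on the limacon, body [l] is the sum of two rotating
    vectors, of angular velocities [1] and [p], whose phases are [turn N l]
    and [turn N (p * l)].  Couplings that depend only on the cyclic distance
    form a circulant matrix, and such a pattern of phases is a discrete
    Fourier mode, hence an eigenvector: the force on the mode [k] is
    [- stiffness N w k] times the mode itself ([sum_circle_differences]).
    As the two rotations are linearly independent functions of time
    ([circle_modes_free]), the equations of motion say exactly that the
    eigenvalue is [1] for the mode [1] and [p ^ 2] for the mode [p]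
    ([limacon_solves_stiffness]).

    Write the couplings as [s + (-1) ^+ d * r] at cyclic distance [d], with
    [s = (ko + ke) / 2] and [r = (ke - ko) / 2].  Constant couplings have
    eigenvalue [N] on every mode not divisible by [N], and every coupling has
    eigenvalue [0] on the others.  Hence [N] must not divide [p], and then
    [s] and [r] solve
      [s * N + r * alternation N 1 = 1] and
      [s * N + r * alternation N p = p ^ 2].
    Since [p ^ 2] differs from [1], this system is solvable if and only if
    [alternation N p != alternation N 1], and the solution is then unique.

    It remains to compare the eigenvalues of the alternating coupling.  For
    even [N] the alternating sign shifts modes by [N / 2], so that
    [alternation N k] is [- N] if [k] is [N / 2] modulo [N] and [0] otherwise
    ([alternation_even]).  For odd [N] an alternating Dirichlet kernel shows
    that [alternation N k] determines [cos (turn N k)], that is [k] modulo [N]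
    up to sign ([alternation_odd_inj]), and the system degenerates exactly
    when [p] is [1] or [-1] modulo [N]. *)

Set Implicit Arguments.
Unset Strict Implicit.
Unset Printing Implicit Defensive.

Local Open Scope ring_scope.

(** * Rotations by fractions of a turn and trigonometric sums *)

Section Trigonometry.
Context {R : realType}.
Implicit Types (x y t : R) (k m : int) (N n : nat).

Lemma cosD_2pi_int x m : cos (x + 2 * pi * m%:~R) = cos x.
Proof.
have cosDn n y : cos (y + 2 * pi * n%:R) = cos y.
  by rewrite mulr_natl mulr_natr (periodicn (@cosD2pi R)).
case: m => n; first exact: cosDn.
by rewrite -[RHS](cosDn n.+1 x) NegzE mulrNz mulrN -[in RHS](cosDn n.+1)
  -(cosDn n.+1 (x - _)) subrK cosDn.
Qed.

Lemma sinD_2pi_int x m : sin (x + 2 * pi * m%:~R) = sin x.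
Proof. by rewrite -!cosBpihalf addrAC cosD_2pi_int. Qed.

Lemma cos_double_sin x : cos (2 * x) = 1 - 2 * sin x ^+ 2.
Proof. by rewrite mulr_natl cos_mulr2n cos2sin2; ring. Qed.

Lemma cos_double_cos x : cos (2 * x) = 2 * cos x ^+ 2 - 1.
Proof. by rewrite mulr_natl cos_mulr2n; ring. Qed.

(** Doubling the angle turns the zero of [sin] into [cos (2 pi m / N) = 1],
    which only depends on [m] modulo [N]; for the residue [0 <= r < N] the
    angle [pi r / N] lies in [[0, pi[], where [sin] vanishes only at [0]. *)
Lemma sin_pi_int_frac_eq0 N m :
  (0 < N)%N -> sin (pi * m%:~R / N%:R : R) = 0 -> (N %| m)%Z.
Proof.
move=> N0 sm0.
have N0R : N%:R != 0 :> R by rewrite pnatr_eq0 -lt0n.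
have Nr : N%:~R = N%:R :> R by [].
have r0 : (0 <= m %% N)%Z by rewrite modz_ge0 // eqz_nat -lt0n.
have rN : (m %% N < N%:Z)%Z by rewrite ltz_pmod.
have : cos (2 * (pi * (m %% N)%Z%:~R / N%:R)) = 1 :> R.
  rewrite -(cosD_2pi_int _ (m %/ N)%Z).
  transitivity (cos (2 * (pi * m%:~R / N%:R)) : R).
    congr cos; move: (divz_eq m N); move: (m %/ N)%Z (m %% N)%Z => q r ->.
    by rewrite rmorphD rmorphM /= Nr; field.
  by rewrite cos_double_sin sm0 expr0n mulr0 subr0.
rewrite cos_double_sin => s0.
have {}s0 : sin (pi * (m %% N)%Z%:~R / N%:R) = 0 :> R.
  by apply/eqP; rewrite -sqrf_eq0; apply/eqP; lra.
apply/dvdz_mod0P/eqP; rewrite -[_ == _]negbK; apply/negP => rn0.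
have rpos : (0 < (m %% N)%Z)%R by rewrite lt_neqAle r0 andbT eq_sym.
have : 0 < sin (pi * (m %% N)%Z%:~R / N%:R : R).
  apply: sin_gt0_pi; rewrite divr_gt0 ?mulr_gt0 ?pi_gt0 ?ltr0z ?ltr0n //=.
  by rewrite ltr_pdivrMr ?ltr0n // ltr_pM2l ?pi_gt0 // -Nr ltr_int.
by rewrite s0 ltxx.
Qed.

(** Differentiating a rotating unit vector multiplies it by its angular
    velocity and turns it by a quarter, so the second derivative is
    proportional to the vector itself. *)
Lemma is_derive_circle x (k c : R) :
  is_derive x 1 (fun t => circle (k * t + c)) (k *: circle (k * x + c + pi / 2)).
Proof.
have lin : is_derive x 1 (fun t : R => k * t + c) k.
  by apply: is_derive_eq; rewrite addr0 -[RHS]mulr1.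
have dc : is_derive x 1 (cos \o (fun t : R => k * t + c))
   (- sin (k * x + c) * k) by apply: is_derive1_comp.
have ds : is_derive x 1 (sin \o (fun t : R => k * t + c))
   (cos (k * x + c) * k) by apply: is_derive1_comp.
have der i j : is_derive x 1 (fun t : R => circle (k * t + c) i j)
    ((k *: circle (k * x + c + pi / 2)) i j).
  rewrite (_ : (fun t : R => _) = if j == 0 then cos \o (fun t : R => k * t + c)
     else sin \o (fun t : R => k * t + c)); last first.
    by apply/funext => t; rewrite mxE; case: (j == 0).
  by rewrite !mxE; case: (j == 0); rewrite ?cosDpihalf ?sinDpihalf mulrC.
have dmx : derivable (fun t : R => circle (k * t + c)) x 1.
  by apply/derivable_mxP => i j; case: (der i j).
by apply: DeriveDef => //; rewrite derive_mx //; apply/matrixP => i j;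
  rewrite mxE; case: (der i j).
Qed.

Lemma circleDpi x : circle (x + pi) = - circle x.
Proof.
by apply/rowP => i; rewrite !mxE; case: (i == 0); rewrite ?cosDpi ?sinDpi.
Qed.

Lemma derive1_circle (k c : R) x :
  derive1 (fun t => circle (k * t + c)) x = k *: circle (k * x + (c + pi / 2)).
Proof. by rewrite derive1E addrA; case: (is_derive_circle x k c). Qed.

(** The rotation by [y], written in the orthonormal frame formed by
    [circle x] and its quarter turn. *)
Lemma circleD x y :
  circle (x + y) = cos y *: circle x + sin y *: circle (x + pi / 2).
Proof.
apply/rowP => i; rewrite !mxE; case: (i == 0).
  by rewrite cosD cosDpihalf mulrN [sin y * _]mulrC [cos y * _]mulrC.
by rewrite sinD sinDpihalf addrC [sin y * _]mulrC [cos y * _]mulrC addrC.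
Qed.

(** The angle of [m] steps around the regular [N]-gon, the phase by which the
    bodies of a choreography differ. *)
Definition turn N m : R := 2 * pi * m%:~R / N%:R.

Lemma turn0 N : turn N 0 = 0.
Proof. by rewrite /turn mulr0 mul0r. Qed.

Lemma turnD N k m : turn N (k + m) = turn N k + turn N m.
Proof. by rewrite /turn rmorphD mulrDr mulrDl. Qed.

Lemma turnN N k : turn N (- k) = - turn N k.
Proof. by rewrite /turn rmorphN mulrN mulNr. Qed.

Lemma turn_full N m : (0 < N)%N -> turn N (m * N) = 2 * pi * m%:~R.
Proof.
move=> N0; rewrite /turn rmorphM /= mulrA mulfK //.
by rewrite -[N%:~R]/(N%:R : R) pnatr_eq0 -lt0n.
Qed.

Lemma circle_turn_mod N x k m : (0 < N)%N -> (N %| k - m)%Z ->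
  circle (x + turn N k) = circle (x + turn N m).
Proof.
move=> N0 /dvdzP[q qE]; have -> : k = m + q * N by rewrite -qE subrKC.
rewrite turnD turn_full // addrA.
by apply/rowP => i; rewrite !mxE cosD_2pi_int sinD_2pi_int.
Qed.

Lemma cos_turn_mod N k m : (0 < N)%N -> (N %| k - m)%Z ->
  cos (turn N k) = cos (turn N m).
Proof.
move=> N0 /(circle_turn_mod 0 N0); rewrite !add0r => /rowP /(_ 0).
by rewrite !mxE.
Qed.

(** [cos (x + y) - cos (x - y) = - 2 sin x sin y], with [x] and [y] the half
    sum and half difference of the two angles. *)
Lemma cos_turn_inj N k m : (0 < N)%N -> cos (turn N k) = cos (turn N m) ->
  (N %| k + m)%Z \/ (N %| k - m)%Z.
Proof.
move=> N0 cE.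
have : sin (pi * (k + m)%:~R / N%:R) * sin (pi * (k - m)%:~R / N%:R) = 0 :> R.
  have N0R : N%:R != 0 :> R by rewrite pnatr_eq0 -lt0n.
  set x := pi * _ / _; set y := pi * _ / _.
  have kE : turn N k = x + y.
    by rewrite /turn /x /y rmorphD rmorphB /=; field.
  have mE : turn N m = x - y.
    by rewrite /turn /x /y rmorphD rmorphB /=; field.
  by move: cE; rewrite kE mE cosB cosD; lra.
move/eqP; rewrite mulf_eq0 => /orP[] /eqP /sin_pi_int_frac_eq0 -> //.
  by left.
by right.
Qed.

(** Each product [2 sin x cos (2 x d)] is a difference
    [sin ((2 d + 1) x) - sin ((2 d - 1) x)], so the sum telescopes. *)
Lemma sum_cos_arith n x :
  2 * sin x * \sum_(d < n) cos (2 * x * d%:R) = sin (2 * x * n%:R - x) + sin x.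
Proof.
elim: n => [|n IH]; first by rewrite big_ord0 !mulr0 sub0r sinN addNr.
rewrite big_ord_recr /= mulrDr IH.
have -> : 2 * x * n.+1%:R - x = 2 * x * n%:R + x by rewrite -natr1; ring.
rewrite sinB sinD; ring.
Qed.

(** The vanishing of the sum of the powers of a nontrivial [N]-th root of
    unity: in [sum_cos_arith] with [x = pi k / N], the two boundary terms
    cancel by periodicity and [sin x] is nonzero. *)
Lemma sum_cos_turn N k : (0 < N)%N ->
  \sum_(d < N) cos (turn N (k * d)) = if (N %| k)%Z then N%:R else 0.
Proof.
move=> N0; have [Nk|Nk] := boolP (N %| k)%Z.
  rewrite (eq_bigr (fun=> 1)) => [|d _]; last first.
    by rewrite (@cos_turn_mod _ _ 0) ?turn0 ?cos0 // subr0 dvdz_mulr.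
  by rewrite sumr_const card_ord.
have N0R : N%:R != 0 :> R by rewrite pnatr_eq0 -lt0n.
pose x : R := pi * k%:~R / N%:R.
have sx : sin x != 0 by apply: contraNneq Nk; exact: sin_pi_int_frac_eq0.
apply: (mulfI (mulf_neq0 (_ : 2 != 0) sx)) => //; rewrite mulr0.
rewrite (eq_bigr (fun d : 'I_N => cos (2 * x * d%:R))) => [|d _]; last first.
  by congr cos; rewrite /turn /x rmorphM /= -[d%:~R]/(d%:R : R); field.
rewrite sum_cos_arith.
have -> : 2 * x * N%:R - x = - x + 2 * pi * k%:~R by rewrite /x; field.
by rewrite sinD_2pi_int sinN addNr.
Qed.

(** The Dirichlet kernel with alternating signs: multiplying by [cos x]
    instead of [sin x] makes the alternating sum telescope. *)
Lemma alternating_dirichlet n x :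
  (1 + 2 * \sum_(1 <= d < n.+1) (-1) ^+ d * cos (2 * x * d%:R)) * cos x
  = (-1) ^+ n * cos ((2 * n%:R + 1) * x).
Proof.
elim: n => [|n IH].
  by rewrite big_geq // !mulr0 addr0 add0r !mul1r.
rewrite big_nat_recr //= mulrDr addrA mulrDl IH exprS.
have -> : (2 * n%:R + 1) * x = 2 * x * n.+1%:R - x by rewrite -natr1; ring.
have -> : (2 * n.+1%:R + 1) * x = 2 * x * n.+1%:R + x by ring.
rewrite cosB cosD; ring.
Qed.

Lemma cos_int_pi_sqr m : cos (m%:~R * pi) ^+ 2 = 1 :> R.
Proof.
have := cos_double_cos (m%:~R * pi); have := cosD_2pi_int 0 m.
rewrite add0r cos0 (_ : 2 * (m%:~R * pi) = 2 * pi * m%:~R); last by ring.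
by move=> ->; lra.
Qed.

End Trigonometry.

(** * Eigenvalues of circulant couplings *)

Section Stiffness.
Context {R : realType}.
Implicit Types (x y t : R) (k m : int) (N n : nat) (w : nat -> R).

(** The circulant force matrix has eigenvalue [- stiffness N w k] on the
    configuration whose [l]-th body sits at angle [turn N (k * l)], where
    [w d] is the coupling at cyclic distance [d]. *)
Definition stiffness N w k : R :=
  \sum_(d < N) w (minn d (N - d)) * (1 - cos (turn N (k * d))).

(** The eigenvalues of the couplings whose sign alternates with the cyclic
    distance.  Any couplings depending only on the parity of the distance are
    a combination of these and of constant couplings. *)
Definition alternation N k : R := stiffness N (fun d => (-1) ^+ d) k.

Lemma stiffness_comb N (s r : R) w w' k :
  stiffness N (fun d => s * w d + r * w' d) k
  = s * stiffness N w k + r * stiffness N w' k.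
Proof.
rewrite /stiffness !mulr_sumr -big_split /=.
by apply: eq_bigr => d _; ring.
Qed.

Lemma stiffness_cos_eq N w k m :
  (forall d, cos (turn N (k * d%:Z)) = cos (turn N (m * d%:Z)) :> R) ->
  stiffness N w k = stiffness N w m.
Proof. by move=> kmE; apply: eq_bigr => d _; rewrite kmE. Qed.

Lemma stiffness_mod N w k m : (0 < N)%N -> (N %| k - m)%Z ->
  stiffness N w k = stiffness N w m.
Proof.
move=> N0 Nkm; apply: stiffness_cos_eq => d; apply: cos_turn_mod => //.
by rewrite -mulrBl dvdz_mulr.
Qed.

Lemma stiffnessN N w k : stiffness N w (- k) = stiffness N w k.
Proof. by apply: stiffness_cos_eq => d; rewrite mulNr turnN cosN. Qed.

Lemma stiffness0 N w : stiffness N w 0 = 0.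
Proof.
by rewrite /stiffness big1 // => d _; rewrite mul0r turn0 cos0 subrr mulr0.
Qed.

(** This makes the modes [1] and [p] indistinguishable for the couplings when
    [p] is [1] or [-1] modulo [N], although they need different
    eigenvalues. *)
Lemma alternation_dvd N k m : (0 < N)%N -> (N %| k + m)%Z || (N %| k - m)%Z ->
  alternation N k = alternation N m.
Proof.
move=> N0 /orP[] Nkm; last exact: stiffness_mod.
by rewrite /alternation -(stiffnessN _ _ m); apply: stiffness_mod; rewrite // opprK.
Qed.

(** With unit couplings every body is attracted by the centre of mass, which
    is at the origin for each mode [k] not divisible by [N]. *)
Lemma stiffness_uniform N k : (0 < N)%N -> ~~ (N %| k)%Z ->
  stiffness N (fun=> 1) k = N%:R.
Proof.
move=> N0 Nk; rewrite /stiffness; under eq_bigr do rewrite mul1r.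
by rewrite sumrB sum_cos_turn // (negPf Nk) subr0 sumr_const card_ord.
Qed.

Lemma signr_minn_subn N d : ~~ odd N -> (d <= N)%N ->
  (-1) ^+ minn d (N - d) = (-1) ^+ d :> R.
Proof.
move=> Ne dN; rewrite -signr_odd -[RHS]signr_odd; congr (_ ^+ nat_of_bool _).
have [//|_] := leqP d (N - d).
by rewrite oddB // (negPf Ne).
Qed.

Lemma cos_turn_half N k (d : nat) : ~~ odd N -> (0 < N)%N ->
  (-1) ^+ d * cos (turn N (k * d)) = cos (turn N ((k - N./2%:Z) * d)) :> R.
Proof.
move=> Ne N0; rewrite -(alternatingn (@cosDpi R)).
rewrite mulrBl turnD turnN -(cosD_2pi_int (_ - _) d); congr cos.
rewrite -addrA; congr (_ + _); rewrite /turn rmorphM /=.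
have -> : N%:R = 2 * N./2%:R :> R.
  by rewrite -natrM mul2n; congr _%:R; move: Ne; lia.
have h0 : N./2%:R != 0 :> R by rewrite pnatr_eq0; move: N0 Ne; lia.
rewrite -[N./2%:~R]/(N./2%:R : R) -[d%:~R]/(d%:R : R) -mulr_natl.
by field; rewrite h0.
Qed.

(** For even [N] the parity of the cyclic distance is that of [d] itself, so
    the sign [(-1) ^+ d] amounts to a shift of the mode [k] by [N / 2], and
    the sum is again one over roots of unity. *)
Lemma alternation_even N k : ~~ odd N -> (0 < N)%N ->
  alternation N k = if (N %| k - N./2%:Z)%Z then - N%:R else 0.
Proof.
move=> Ne N0; rewrite /alternation /stiffness.
under eq_bigr => d _ do
  rewrite signr_minn_subn ?(ltnW (ltn_ord d)) // mulrBr mulr1 cos_turn_half //.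
rewrite sumrB sum_cos_turn //.
have -> : \sum_(d < N) (-1) ^+ d = 0 :> R.
  have -> : \sum_(d < N) (-1) ^+ d =
      \sum_(d < N) cos (turn N ((0 - N./2%:Z) * d)) :> R.
    by apply: eq_bigr => d _; rewrite -cos_turn_half // mul0r turn0 cos0 mulr1.
  rewrite sum_cos_turn // sub0r dvdzE abszN /= gtnNdvd //; move: Ne N0; lia.
by case: ifP; rewrite sub0r ?oppr0.
Qed.

(** For odd size the indices pair up under [d <-> N - d], apart from [0]. *)
Lemma sum_fold_odd n (f : nat -> R) :
  \sum_(d < n.*2.+1) f (minn d (n.*2.+1 - d)) = f 0%N + 2 * \sum_(1 <= d < n.+1) f d.
Proof.
rewrite -(big_mkord xpredT (fun d => f (minn d (n.*2.+1 - d)))) big_ltn // min0n.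
congr (_ + _); rewrite (@big_cat_nat _ _ _ n.+1) /=; [|lia|lia].
rewrite mulrDl !mul1r; congr (_ + _).
  rewrite !big_nat; apply: eq_bigr => d /andP[d1 dn]; congr f; lia.
rewrite big_nat_rev /= [in RHS]big_add1 [in LHS](_ : n.+1 = 0 + n.+1)%N //.
rewrite big_addn !big_mkord (_ : n.*2.+1 - n.+1 = n)%N; last lia.
by apply: eq_bigr => -[d dn] _; congr f => /=; lia.
Qed.

(** With [x = pi k / N], the folded sum is an alternating Dirichlet kernel, so
    its product with [cos x] is up to sign [cos (k pi)], that is [1] or [-1].
    Squaring removes this sign, which depends on [k], and leaves an identity
    in which [k] occurs only through [2 * cos x ^+ 2 = 1 + cos (turn N k)]. *)
Lemma alternating_cos_sum_odd N k : odd N ->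
  (\sum_(d < N) (-1) ^+ minn d (N - d) * cos (turn N (k * d))) ^+ 2
  * (1 + cos (turn N k)) = 2 :> R.
Proof.
move=> No; have N0 : (0 < N)%N by case: N No.
pose n := N./2; have NE : N = n.*2.+1 by rewrite /n; lia.
have N0R : N%:R != 0 :> R by rewrite pnatr_eq0 -lt0n.
pose x : R := pi * k%:~R / N%:R.
have xE (d : nat) : turn N (k * d) = 2 * x * d%:R :> R.
  by rewrite /turn /x rmorphM /= -[d%:~R]/(d%:R : R); field.
pose f d : R := (-1) ^+ d * cos (2 * x * d%:R).
have -> : \sum_(d < N) (-1) ^+ minn d (N - d) * cos (turn N (k * d)) =
    \sum_(d < N) f (minn d (N - d)).
  apply: eq_bigr => d _; rewrite /f; congr (_ * _).
  have [_|_] := leqP d (N - d); first by rewrite xE.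
  rewrite -xE -[RHS]cosN -turnN; apply: cos_turn_mod => //.
  rewrite opprK -mulrDr dvdz_mull // -PoszD subnKC ?dvdzz //; exact: ltnW.
rewrite NE sum_fold_odd -NE {1}/f mulr0 cos0 mulr1 expr0.
have <- : turn N (k * 1) = turn N k :> R by rewrite mulr1.
rewrite xE mulr1 cos_double_cos.
have := alternating_dirichlet n x; rewrite -/(f _).
rewrite (_ : (2 * n%:R + 1) * x = k%:~R * pi); last first.
  have nE : N%:R = 2 * n%:R + 1 :> R by rewrite NE -natr1 -mul2n natrM.
  by rewrite -nE /x; field.
move=> /(congr1 (fun z => z ^+ 2)).
rewrite exprMn [in RHS]exprMn sqrr_sign cos_int_pi_sqr /f; lra.
Qed.

(** By [alternating_cos_sum_odd] the eigenvalue determines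
    [cos (turn N k)]. *)
Lemma alternation_odd_inj N k m : odd N ->
  alternation N k = alternation N m :> R ->
  (N %| k + m)%Z \/ (N %| k - m)%Z.
Proof.
move=> No; have N0 : (0 < N)%N by case: N No.
have split_one l : alternation N l =
    \sum_(d < N) (-1) ^+ minn d (N - d)
    - \sum_(d < N) (-1) ^+ minn d (N - d) * cos (turn N (l * d)) :> R.
  by rewrite -sumrB; apply: eq_bigr => d _; rewrite mulrBr mulr1.
rewrite !split_one => /addrI /oppr_inj GE; apply: (@cos_turn_inj R) => //.
have := alternating_cos_sum_odd k No; have := alternating_cos_sum_odd m No.
rewrite GE; set G2 := _ ^+ 2 => Gm; rewrite -Gm => /mulfI; rewrite addrC.
have G0 : G2 != 0 by apply/eqP => G0; move: Gm; rewrite G0 mul0r; lra.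
by move=> /(_ G0); rewrite addrC => /addrI.
Qed.

End Stiffness.

(** * From the equations of motion to a linear system *)

Section Dynamics.
Context {R : realType}.
Implicit Types (x y t a b ko ke : R) (k m p : int) (N n : nat) (w : nat -> R).

Lemma limacon_choreographyE N p a b (j : 'I_N) t :
  choreography (limacon p a b) j t =
  a *: circle (t + turn N j) + b *: circle (p%:~R * t + turn N (p * j)).
Proof.
rewrite /choreography /limacon; congr (_ *: circle _ + _ *: circle _).
by rewrite mulrDr /turn rmorphM /= -[j%:~R]/(j%:R : R); ring.
Qed.

Lemma derive1_lin2 (V : normedModType R) a b (f g : R -> V) t :
  derivable f t 1 -> derivable g t 1 ->
  derive1 (fun u => a *: f u + b *: g u) t = a *: derive1 f t + b *: derive1 g t.
Proof.
move=> df dg; rewrite !derive1E.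
rewrite (@deriveD _ _ _ (a \*: f) (b \*: g)); [|exact: derivableZ..].
by rewrite (deriveZ a df) (deriveZ b dg).
Qed.

Lemma derive1n2_limacon_choreography N p a b (j : 'I_N) t :
  derive1n 2 (choreography (limacon p a b) j) t =
  - (a *: circle (t + turn N j))
  - (b * p%:~R ^+ 2) *: circle (p%:~R * t + turn N (p * j)).
Proof.
have dcircle (k c x : R) : derivable (fun u => circle (k * u + c)) x 1.
  by case: (is_derive_circle x k c).
have -> : choreography (limacon p a b) j = fun u =>
    a *: circle (1 * u + turn N j) + b *: circle (p%:~R * u + turn N (p * j)).
  by apply/funext => u; rewrite mul1r limacon_choreographyE.
rewrite derive1nS derive1n1.
have -> : derive1 (fun u => a *: circle (1 * u + turn N j)
      + b *: circle (p%:~R * u + turn N (p * j))) = fun u =>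
    a *: circle (1 * u + (turn N j + pi / 2))
    + (b * p%:~R) *: circle (p%:~R * u + (turn N (p * j) + pi / 2)).
  apply/funext => u; rewrite derive1_lin2 // !derive1_circle.
  by rewrite scale1r scalerA.
rewrite derive1_lin2 // !derive1_circle scale1r scalerA mul1r -mulrA -expr2.
(* Each derivative contributes a quarter turn, whence the minus signs. *)
have halves (c : R) : c + pi / 2 + pi / 2 = c + pi by field.
by rewrite !halves !(addrA _ _ pi) !circleDpi !scalerN.
Qed.

(** The cyclic symmetry diagonalizes the force: for [l = j + d] modulo [N],
    the vector of body [l] is that of body [j] rotated by [turn N (k * d)].
    The components along the quarter turn of [circle x] are odd under
    [d -> - d] while the couplings are even, so that only the cosines
    survive. *)
Lemma sum_circle_differences N w k x (j : 'I_N) :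
  \sum_(l < N | l != j) w (cyclic_dist j l) *:
     (circle (x + turn N (k * l)) - circle (x + turn N (k * j)))
  = - stiffness N w k *: circle (x + turn N (k * j)).
Proof.
case: N j => [[]//|n] j; set N := n.+1; set y := x + turn N (k * j).
have distE (d : 'I_N) : cyclic_dist j (j + d) = minn d (N - d).
  rewrite /cyclic_dist /=.
  move: (nat_of_ord j) (nat_of_ord d) (ltn_ord j) (ltn_ord d).
  rewrite -/N => i e iN eN; have [lt|le] := ltnP (i + e) N.
    by rewrite modn_small //; lia.
  have -> : ((i + e) %% N = i + e - N)%N.
    by rewrite -{1}(subnK le) modnDr modn_small //; lia.
  lia.
have circE (d : 'I_N) : circle (x + turn N (k * (j + d)%R)) =
    circle (y + turn N (k * d)).
  rewrite /y -addrA -turnD -mulrDr -PoszD; apply: circle_turn_mod => //.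
  rewrite -mulrBr dvdz_mull //.
  by rewrite -eqz_mod_dvd -modz_nat modz_mod.
(* Ordinals below [n.+1] carry addition modulo [n.+1]. *)
rewrite (reindex_inj (addrI j)).
pose c (d : 'I_N) := w (minn d (N - d)).
pose S := \sum_(d < N | d != 0) c d * sin (turn N (k * d)).
have S0 : S = 0.
  suff : S = - S by lra.
  rewrite {1}/S (reindex_inj oppr_inj) -sumrN.
  apply: eq_big => d; first by rewrite oppr_eq0.
  rewrite oppr_eq0 => d0.
  have nd : (- d : 'I_N) = (N - d)%N :> nat.
    have d_gt0 : (0 < nat_of_ord d)%N by rewrite lt0n; exact: d0.
    by rewrite /= modn_small // ltn_subrL d_gt0.
  rewrite /c nd -[RHS]mulrN -sinN -turnN; congr (w _ * _).
    by rewrite subKn 1?minnC // ltnW.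
  rewrite -subzn ?(ltnW (ltn_ord d)) // mulrBr turnD -mulrN turn_full // addrC.
  by rewrite mulrN sinD_2pi_int.
transitivity (\sum_(d < N | d != 0) ((c d * (cos (turn N (k * d)) - 1)) *: circle y
    + (c d * sin (turn N (k * d))) *: circle (y + pi / 2))).
  apply: eq_big => d; first by rewrite -[X in _ != X]addr0 (inj_eq (addrI j)).
  move=> _; rewrite circE distE circleD addrAC -{2}[circle y]scale1r -scalerBl.
  by rewrite scalerDr !scalerA.
rewrite big_split /= -!scaler_suml -/S S0 scale0r addr0; congr (_ *: _).
rewrite /stiffness -sumrN [RHS](bigD1 ord0) //=.
rewrite mulr0 turn0 cos0 subrr mulr0 oppr0 add0r.
by apply: eq_bigr => d _; rewrite -mulrN opprB.
Qed.

Lemma cyclic_dist_range N (j l : 'I_N) : j != l ->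
  (1 <= cyclic_dist j l <= N./2)%N.
Proof.
rewrite -val_eqE /= /cyclic_dist => jl; have := ltn_ord j; have := ltn_ord l.
move: jl; lia.
Qed.

Definition parity_coef ko ke (d : nat) : R := if odd d then ko else ke.

Lemma limacon_solves_equations N p a b ko ke :
  limacon_choreography_solves N p a b ko ke <->
  forall (j : 'I_N) t,
    (a * (stiffness N (parity_coef ko ke) 1 - 1)) *: circle (t + turn N j)
    + (b * (stiffness N (parity_coef ko ke) p - p%:~R ^+ 2)) *:
       circle (p%:~R * t + turn N (p * j)) = 0.
Proof.
set w := parity_coef ko ke.
have eqE (j : 'I_N) t :
    derive1n 2 (choreography (limacon p a b) j) t -
    \sum_(l < N | l != j) w (cyclic_dist j l) *:
      (choreography (limacon p a b) l t - choreography (limacon p a b) j t) =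
    (a * (stiffness N w 1 - 1)) *: circle (t + turn N j)
    + (b * (stiffness N w p - p%:~R ^+ 2)) *:
       circle (p%:~R * t + turn N (p * j)).
  rewrite derive1n2_limacon_choreography.
  have -> : \sum_(l < N | l != j) w (cyclic_dist j l) *:
      (choreography (limacon p a b) l t - choreography (limacon p a b) j t) =
      a *: (- stiffness N w 1 *: circle (t + turn N (1%:Z * j))) +
      b *: (- stiffness N w p *: circle (p%:~R * t + turn N (p * j))).
    rewrite -!sum_circle_differences !scaler_sumr -big_split /=.
    apply: eq_bigr => l _; rewrite !limacon_choreographyE !mul1r.
    rewrite !scalerA ![_ * w _]mulrC -!scalerA -scalerDr; congr (_ *: _).
    by rewrite !scalerBr opprD addrACA.
  by apply/rowP => i; rewrite mul1r !mxE; ring.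
split=> [[kappa [kd [kappaE kdE eom]]] j t|eom].
  rewrite -eqE eom; apply/eqP; rewrite subr_eq0; apply/eqP; apply: eq_bigr => l lj.
  rewrite eq_sym in lj.
  by rewrite kappaE // kdE // cyclic_dist_range.
exists (fun j l => w (cyclic_dist j l)), w; split=> // j t.
by apply/eqP; rewrite -subr_eq0 eqE eom.
Qed.

Lemma circle_neq0 x : circle x != 0.
Proof.
apply/eqP => /rowP c0; have := cos2Dsin2 x.
have := c0 0; have := c0 1; rewrite !mxE /= => -> ->; lra.
Qed.

(** At [t = 0] the two vectors agree, and at [t = pi / (p - 1)] they are
    opposite, since there [p * t = t + pi]. *)
Lemma circle_modes_free p (u v : R) : p != 1 ->
  (forall t, u *: circle t + v *: circle (p%:~R * t) = 0) -> u = 0 /\ v = 0.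
Proof.
move=> p1 uv0.
have uDv : u + v = 0.
  apply/eqP; have /eqP := uv0 0; rewrite mulr0 -scalerDl scaler_eq0.
  by rewrite (negPf (circle_neq0 0)) orbF.
have uBv : u - v = 0.
  have p1R : p%:~R - 1 != 0 :> R by rewrite subr_eq0 -[1]/(1%:~R) eqr_int.
  pose t : R := pi / (p%:~R - 1).
  apply/eqP; have /eqP := uv0 t.
  have -> : p%:~R * t = t + pi by rewrite /t; field.
  by rewrite circleDpi scalerN -scalerBl scaler_eq0 (negPf (circle_neq0 t)) orbF.
by split; lra.
Qed.

(** The equations of motion decouple into the two modes of the curve, of
    frequencies [1] and [p]: each must be an oscillation whose squared
    frequency is the corresponding eigenvalue. *)
Lemma limacon_solves_stiffness N p a b ko ke :
  (0 < N)%N -> p != 1 -> a * b != 0 ->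
  limacon_choreography_solves N p a b ko ke <->
  stiffness N (parity_coef ko ke) 1 = 1 /\
  stiffness N (parity_coef ko ke) p = p%:~R ^+ 2.
Proof.
move=> N0 p1; rewrite mulf_eq0 negb_or => /andP[a0 b0].
rewrite limacon_solves_equations; split=> [eom|[-> ->] j t]; last first.
  by rewrite !subrr !mulr0 !scale0r addr0.
have [|/eqP] := circle_modes_free p1
  (u := a * (stiffness N (parity_coef ko ke) 1 - 1))
  (v := b * (stiffness N (parity_coef ko ke) p - p%:~R ^+ 2)).
  by move=> t; have := eom (Ordinal N0) t; rewrite /= mulr0 turn0 !addr0.
rewrite mulf_eq0 (negPf a0) /= subr_eq0 => /eqP -> /eqP.
by rewrite mulf_eq0 (negPf b0) /= subr_eq0 => /eqP ->.
Qed.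

(** A parity coupling is [s + (-1) ^+ d * r] with [s = (ko + ke) / 2] and
    [r = (ke - ko) / 2], so the two conditions form a linear system in
    [s] and [r].  If [N] divides [p], the second mode moves all bodies in
    unison, feels no force, and cannot oscillate. *)
Lemma limacon_solves_linear N p a b ko ke :
  (1 < N)%N -> p != 0 -> p != 1 -> a * b != 0 ->
  limacon_choreography_solves N p a b ko ke <->
  [/\ ~~ (N %| p)%Z,
      (ko + ke) / 2 * N%:R + (ke - ko) / 2 * alternation N 1 = 1 &
      (ko + ke) / 2 * N%:R + (ke - ko) / 2 * alternation N p = p%:~R ^+ 2].
Proof.
move=> N1 p0 p1 ab0; have N0 : (0 < N)%N by exact: ltnW.
rewrite limacon_solves_stiffness //.
have splitE k : ~~ (N %| k)%Z -> stiffness N (parity_coef ko ke) k =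
    (ko + ke) / 2 * N%:R + (ke - ko) / 2 * alternation N k.
  move=> Nk; rewrite -(stiffness_uniform N0 Nk) -stiffness_comb.
  congr (stiffness N _ k); apply/funext => d.
  by rewrite /parity_coef -signr_odd; case: odd; rewrite ?expr1 ?expr0; field.
have N_1 : ~~ (N %| 1)%Z by rewrite dvdzE /= dvdn1; lia.
rewrite (splitE _ N_1); split=> [[E1 Ep]|[Np E1 Ep]]; last by rewrite (splitE _ Np).
have Np : ~~ (N %| p)%Z.
  apply/negP => Np; have : stiffness N (parity_coef ko ke) p = 0.
    by rewrite (@stiffness_mod _ _ _ _ 0) ?stiffness0 // subr0.
  by rewrite Ep => /eqP; rewrite expf_eq0 /= intr_eq0 (negPf p0).
by split=> //; rewrite -splitE.
Qed.

Lemma sqr_int_neq1 p : p != 1 -> p != -1 -> p%:~R ^+ 2 != 1 :> R.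
Proof.
move=> p1 pN1; rewrite sqrf_eq1 negb_or -[1]/(1%:~R) -mulrNz !eqr_int.
by rewrite p1.
Qed.

(** If both rows of the linear system have equal coefficients, then so do
    their right-hand sides [1] and [p ^ 2]. *)
Lemma limacon_solves_alternation_neq N p a b ko ke :
  (1 < N)%N -> p != 0 -> p != 1 -> p != -1 -> a * b != 0 ->
  limacon_choreography_solves N p a b ko ke ->
  ~~ (N %| p)%Z /\ alternation N p != alternation N 1 :> R.
Proof.
move=> N1 p0 p1 pN1 ab0; rewrite limacon_solves_linear // => -[Np E1 Ep].
split=> //; apply: contraNneq (sqr_int_neq1 p1 pN1) => EpE1.
by rewrite -Ep EpE1 E1.
Qed.

(** Otherwise the system is regular: [r] is found by subtracting the two
    equations, and then [s] from the first one. *)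
Lemma limacon_solves_unique N p :
  (1 < N)%N -> p != 0 -> p != 1 ->
  ~~ (N %| p)%Z -> alternation N p != alternation N 1 :> R ->
  exists ko0 ke0 : R, forall a b, a * b != 0 -> forall ko ke,
    limacon_choreography_solves N p a b ko ke <-> ko = ko0 /\ ke = ke0.
Proof.
move=> N1 p0 p1 Np Ep1.
have D0 : alternation N p - alternation N 1 != 0 :> R by rewrite subr_eq0.
have N0 : N%:R != 0 :> R by rewrite pnatr_eq0; lia.
pose r : R := (p%:~R ^+ 2 - 1) / (alternation N p - alternation N 1).
pose s : R := (1 - r * alternation N 1) / N%:R.
exists (s - r), (s + r) => a b ab0 ko ke; rewrite limacon_solves_linear //.
split=> [[_ E1 Ep]|[-> ->]].
  have rE : r = (ke - ko) / 2.
    by apply: (mulIf D0); rewrite /r divfK //; lra.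
  have sE : s = (ko + ke) / 2 by apply: (mulIf N0); rewrite /s divfK // rE; lra.
  by rewrite rE sE; split; field.
have sE : s * N%:R = 1 - r * alternation N 1 by rewrite /s; field.
have rE : r * (alternation N p - alternation N 1) = p%:~R ^+ 2 - 1.
  by rewrite /r; field.
by split=> //; lra.
Qed.

Lemma rat_div_int N k : (0 < N)%N ->
  (k%:Q / N%:Q \is a Num.int) = (N %| k)%Z.
Proof.
move=> N0; have N0Q : N%:Q != 0 by rewrite intr_eq0; lia.
apply/intrP/dvdzP => -[q qE]; exists q; last first.
  by rewrite qE rmorphM /= mulfK.
by apply: (intr_inj (R := rat)); rewrite rmorphM /= -qE divfK.
Qed.

End Dynamics.

Theorem theorem2 (R : realType) (N : nat) (p : int)
    (hN : (4 <= N)%N) (hp0 : p != 0) (hp1 : p != 1) (hpN1 : p != -1) :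
  (~~ odd N -> forall a b : R, a * b != 0 ->
     ((exists ko ke : R, limacon_choreography_solves N p a b ko ke) <->
      [/\ p%:Q / N%:Q \isn't a Num.int,
          (p + 1)%:Q / N%:Q \isn't a Num.int,
          (p - 1)%:Q / N%:Q \isn't a Num.int &
          (p = N./2 %[mod N])%Z]) /\
     (forall ko ke : R, limacon_choreography_solves N p a b ko ke ->
        ko = p%:~R ^+ 2 / N%:R /\ ke = (2 - p%:~R ^+ 2) / N%:R)) /\
  (odd N ->
     (forall a b : R, a * b != 0 ->
        (exists ko ke : R, limacon_choreography_solves N p a b ko ke) <->
        [/\ p%:Q / N%:Q \isn't a Num.int,
            (p + 1)%:Q / N%:Q \isn't a Num.int &
            (p - 1)%:Q / N%:Q \isn't a Num.int]) /\
     ([/\ p%:Q / N%:Q \isn't a Num.int,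
          (p + 1)%:Q / N%:Q \isn't a Num.int &
          (p - 1)%:Q / N%:Q \isn't a Num.int] ->
      exists ko0 ke0 : R, forall a b : R, a * b != 0 ->
        forall ko ke : R,
          limacon_choreography_solves N p a b ko ke <->
          ko = ko0 /\ ke = ke0)).
Proof.
have N1 : (1 < N)%N by lia.
have N0 : (0 < N)%N by lia.
have N0R : N%:R != 0 :> R by rewrite pnatr_eq0 -lt0n.
rewrite !rat_div_int //.
have necessary (a b ko ke : R) : a * b != 0 ->
    limacon_choreography_solves N p a b ko ke ->
    [/\ ~~ (N %| p)%Z, ~~ (N %| p + 1)%Z, ~~ (N %| p - 1)%Z &
        alternation (R := R) N p != alternation N 1].
  move=> ab0 sol.
  have [Np Ep] := limacon_solves_alternation_neq N1 hp0 hp1 hpN1 ab0 sol.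
  split=> //; apply: contraNN Ep => Np1; apply/eqP; apply: alternation_dvd => //.
    by rewrite Np1.
  by rewrite Np1 orbT.
split=> [Ne a b ab0|No].
  have E1 : alternation (R := R) N 1 = 0.
    rewrite alternation_even // ifN //.
    by rewrite dvdzE gtnNdvd //; lia.
  have Ep : alternation (R := R) N p = if (p == N./2 %[mod N])%Z then - N%:R else 0.
    by rewrite alternation_even // eqz_mod_dvd.
  have halfE ko ke : limacon_choreography_solves N p a b ko ke ->
      (p = N./2 %[mod N])%Z.
    move=> /(necessary _ _ _ _ ab0)[_ _ _]; rewrite E1 Ep.
    by case: ifP => [/eqP//|_]; rewrite eqxx.
  split; last first.
    move=> ko ke sol; have pE := halfE _ _ sol.
    have := sol; rewrite limacon_solves_linear // Ep E1 pE eqxx.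
    rewrite mulr0 addr0 => -[_ sN pp].
    have koE : ko * N%:R = p%:~R ^+ 2 by lra.
    have keE : ke * N%:R = 2 - p%:~R ^+ 2 by lra.
    by split; rewrite -?keE -?koE mulfK.
  split=> [[ko [ke sol]]|[Np _ _ pE]].
    by have [Np Np1 NpN1 _] := necessary _ _ _ _ ab0 sol; have := halfE _ _ sol.
  have [|ko0 [ke0 sol]] := @limacon_solves_unique R _ _ N1 hp0 hp1 Np.
    by rewrite Ep E1 pE eqxx oppr_eq0.
  by exists ko0, ke0; apply/sol.
have unique : [/\ ~~ (N %| p)%Z, ~~ (N %| p + 1)%Z & ~~ (N %| p - 1)%Z] ->
    exists ko0 ke0 : R, forall a b : R, a * b != 0 -> forall ko ke : R,
      limacon_choreography_solves N p a b ko ke <-> ko = ko0 /\ ke = ke0.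
  move=> [Np Np1 NpN1]; apply: limacon_solves_unique => //.
  by apply/eqP => /alternation_odd_inj-/(_ No)[]; apply/negP.
split=> // a b ab0; split=> [[ko [ke sol]]|/unique[ko0 [ke0 sol]]].
  by have [] := necessary _ _ _ _ ab0 sol.
by exists ko0, ke0; apply/sol.
Qed.
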